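(* Let $n, m \geq 1$ be integers, let $\Omega$ be a nonempty open subset of $\mathbb{R}^n$, and let $f_i : \Omega \to \mathbb{R}$, $i \in \{0,\dots,m\}$, be functions. Let $\hat{x}$ be a solution of the problem $$(\mathcal{I})\quad \text{Maximize } f_0(x) \text{ when } x \in \Omega \text{ and when } f_i(x) \geq 0 \text{ for all } i \in \{1,\dots,m\}.$$ Assume that: (i) for all $i \in \{0,\dots,m\}$, $f_i$ is Gâteaux-differentiable at $\hat{x}$; (ii) for all $i \in \{1,\dots,m\}$, $f_i$ is lower semicontinuous at $\hat{x}$ when $f_i(\hat{x}) > 0$. Then there exist $\lambda^0, \dots, \lambda^m \in \mathbb{R}_+$ such that the following conditions hold: (a) $(\lambda^0,\dots,\lambda^m) \neq (0,\dots,0)$; (b) for all $i \in \{1,\dots,m\}$, $\lambda^i f_i(\hat{x}) = 0$; (c) $\sum_{0 \leq i \leq m} \lambda^i D_G f_i(\hat{x}) = 0$. If, in addition, the following assumption is fulfilled: (iii) there exists $w \in \mathbb{R}^n$ such that, for all $i \in \{1,\dots,m\}$, $D_G f_i(\hat{x}).w > 0$ when $f_i(\hat{x}) = 0$, then one can take $\lambda^0 = 1$, i.e. there exist $\lambda^0, \dots, \lambda^m \in \mathbb{R}_+$ satisfying (a), (b), (c) and $\lambda^0 = 1$.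
   Context: $\mathbb{R}_+$ denotes the set of non-negative real numbers. A solution of $(\mathcal{I})$ is a point $\hat{x} \in \Omega$ satisfying $f_i(\hat{x}) \geq 0$ for all $i \in \{1,\dots,m\}$ and such that $f_0(x) \leq f_0(\hat{x})$ for every $x \in \Omega$ satisfying $f_i(x) \geq 0$ for all $i \in \{1,\dots,m\}$. For $f : \Omega \to \mathbb{R}$, $x \in \Omega$ and $v \in \mathbb{R}^n$, the directional derivative of $f$ at $x$ in the direction $v$ is, when it exists, $\vec{D} f(x;v) := \frac{d}{dt}\big|_{t=0} f(x+tv)$. The function $f$ is Gâteaux-differentiable at $x$ when $\vec{D} f(x;v)$ exists for all $v \in \mathbb{R}^n$ and $v \mapsto \vec{D} f(x;v)$ is linear (and continuous); its Gâteaux-differential at $x$ is the linear form $D_G f(x)$ on $\mathbb{R}^n$ defined by $D_G f(x).v := \vec{D} f(x;v)$. Gâteaux-differentiability at a point does not imply continuity at that point. Lower semicontinuity at a point is the classical notion. *)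

(* Defs.v *)
From mathcomp Require Import all_boot all_order all_algebra.
From mathcomp Require Import all_classical all_reals all_analysis.

Set Implicit Arguments.
Unset Strict Implicit.
Unset Printing Implicit Defensive.

Import Order.TTheory GRing.Theory Num.Theory.
Import numFieldNormedType.Exports.

Local Open Scope ring_scope.
Local Open Scope classical_set_scope.

(* A function defined on an open set Omega of R^n is represented by a total
   function on 'rV[R]_n. The optimization problem only reads its values on
   Omega; the notions at a point of Omega below only depend on its values near
   that point, hence not on how it is extended outside Omega. *)

(* The directional derivative ('D_v f x) is the two-sided derivative at t = 0
   of t |-> f (x + t v), when it exists (derivable f x v). *)
Definition gateaux_diff (R : realType) (n : nat) (f : 'rV[R]_n -> R)
    (x v : 'rV[R]_n) : R :=
  'D_v f x.

Definition gateaux_differentiable (R : realType) (n : nat)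
    (f : 'rV[R]_n -> R) (x : 'rV[R]_n) : Prop :=
  [/\ forall v, derivable f x v,
      scalar (gateaux_diff f x) &
      continuous (gateaux_diff f x)].

(* Pointwise version of the library's lower_semicontinuous, for real-valued
   functions. *)
Definition lower_semicontinuous_at (R : realType) (n : nat)
    (f : 'rV[R]_n -> R) (x : 'rV[R]_n) : Prop :=
  forall a : R, a < f x -> \forall y \near x, a < f y.

(* The index ord0 is that of the objective function; the indices i != ord0 are
   those of the constraints. *)
Definition feasible (R : realType) (n m : nat) (Omega : set 'rV[R]_n)
    (f : 'I_m.+1 -> 'rV[R]_n -> R) : set 'rV[R]_n :=
  [set x | Omega x /\ forall i, i != ord0 -> 0 <= f i x].

Definition is_solution (R : realType) (n m : nat) (Omega : set 'rV[R]_n)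
    (f : 'I_m.+1 -> 'rV[R]_n -> R) (xhat : 'rV[R]_n) : Prop :=
  feasible Omega f xhat /\
  forall x, feasible Omega f x -> f ord0 x <= f ord0 xhat.

Definition fritz_john_multipliers (R : realType) (n m : nat)
    (f : 'I_m.+1 -> 'rV[R]_n -> R) (xhat : 'rV[R]_n)
    (lambda : 'I_m.+1 -> R) : Prop :=
  [/\ forall i, 0 <= lambda i,
      lambda <> (fun=> 0),
      forall i, i != ord0 -> lambda i * f i xhat = 0 &
      forall v, \sum_(i < m.+1) lambda i * gateaux_diff (f i) xhat v = 0].

(* Main.v *)
Require Import Defs.
From mathcomp Require Import all_boot all_order all_algebra.
From mathcomp Require Import all_classical all_reals all_analysis.
From mathcomp Require Import ring lra.

Import Order.TTheory GRing.Theory Num.Theory.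
Import numFieldNormedType.Exports.

Local Open Scope ring_scope.
Local Open Scope classical_set_scope.

(** Call an index active if it is that of the objective or of a constraint
    vanishing at [xhat].  If some direction [v] made every active derivative
    positive, then a small positive step from [xhat] along [v] would strictly
    increase the objective and every saturated constraint
    ([increase_along_direction]), while the other constraints would stay
    positive by lower semicontinuity and the point would stay in [Omega]
    ([near_line]): this contradicts the optimality of [xhat].  Only one line
    through [xhat] is involved, which is why directional derivatives suffice
    for the active functions.

    Hence no such [v] exists, and Gordan's theorem of the alternative
    ([gordan_alternative]) yields a nontrivial combination of the active
    differentials, with nonnegative coefficients, that is zero.  Extended by 0
    to the inactive indices, the coefficients are the required multipliers.

    Under the qualification condition, evaluate the combination at [w].  If
    the multiplier of the objective were 0, a sum of nonnegative terms would
    vanish, so each term would; the saturated constraints have positive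
    derivative along [w], so all multipliers would be 0.  One may therefore
    divide by the multiplier of the objective. *)

Lemma scalar_at0 (R : realFieldType) (V : lmodType R) (b : V -> R) :
  scalar b -> b 0 = 0.
Proof. by move=> lb; have := lb (-1) 0 0; rewrite scaler0 addr0; lra. Qed.

Lemma perturb_gt0 (R : realFieldType) (I : finType) (A : {set I}) (p q : I -> R) :
  (forall i, i \in A -> 0 < p i) ->
  exists2 e : R, 0 < e & forall i, i \in A -> 0 < p i + e * q i.
Proof.
move=> p_gt0; pose S := \sum_(i in A) `|q i| / p i.
have term_ge0 i : i \in A -> 0 <= `|q i| / p i.
  by move=> iA; rewrite divr_ge0 // ltW // p_gt0.
have S_ge0 : 0 <= S by rewrite sumr_ge0.
(* This e satisfies e * |q i| < p i, because |q i| / p i <= S < 1 + S. *)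
exists (1 + S)^-1 => [|i iA]; first by rewrite invr_gt0; lra.
have qS : `|q i| < p i * (1 + S).
  rewrite mulrC -ltr_pdivrMr ?p_gt0 // (@le_lt_trans _ _ S) //; last by lra.
  rewrite /S (big_setD1 i) //= lerDl sumr_ge0 // => j /setD1P[_]; exact: term_ge0.
have qe : `|q i| / (1 + S) < p i by rewrite ltr_pdivrMr //; lra.
have : - (`|q i| / (1 + S)) <= (1 + S)^-1 * q i.
  rewrite [leRHS]mulrC -mulNr ler_wpM2r ?invr_ge0 //; first lra.
  by rewrite lerNl -normrN ler_norm.
lra.
Qed.

(** Gordan's theorem by elimination of one form [b] at a time, the others
    being indexed by [B].  By induction, unless the forms in [B] already have
    a nontrivial nonnegative relation, they are all positive at some [v], and
    the only hard case is [b v < 0].  One then replaces each form [a i] by its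
    composite [a' i] with the projection onto the kernel of [b] along [v],
    which is [a i] plus a nonnegative multiple of [b]: a relation between the
    [a' i] is thus one between the [a i] and [b], and a common positivity point
    of the [a' i] projects to a zero of [b] at which every [a i] is positive.
    Arguing with projections avoids both convex separation and bases, so [V]
    may have any dimension. *)
Lemma gordan_alternative (R : realFieldType) (V : lmodType R) (I : finType)
    (A : {set I}) (a : I -> V -> R) : (forall i, scalar (a i)) ->
  (exists v, forall i, i \in A -> 0 < a i v) \/
  (exists c : I -> R, [/\ forall i, i \in A -> 0 <= c i,
     exists2 i, i \in A & c i != 0 &
     forall v, \sum_(i in A) c i * a i v = 0]).
Proof.
have [k] := ubnP #|A|; elim: k => // k IHk in A a * => leAk a_lin.
have [->|[b bA]] := set_0Vmem A.
  by left; exists 0 => i; rewrite inE.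
pose B := A :\ b.
have {IHk leAk} IHB a' := IHk B a' (leq_trans (proper_card (properD1 bA)) leAk).
have splitA i : i \in A -> i = b \/ i \in B.
  by move=> iA; rewrite !inE iA andbT; case: eqVneq; [left | right].
have extend c t : (forall i, i \in B -> 0 <= c i) -> 0 <= t ->
    (t != 0 \/ exists2 i, i \in B & c i != 0) ->
    (forall v, t * a b v + \sum_(i in B) c i * a i v = 0) ->
    exists c : I -> R, [/\ forall i, i \in A -> 0 <= c i,
      exists2 i, i \in A & c i != 0 &
      forall v, \sum_(i in A) c i * a i v = 0].
  move=> c_ge0 t_ge0 nz sum0; exists (fun i => if i == b then t else c i); split.
  - by move=> i /splitA[->|iB]; [rewrite eqxx | case: ifP => // _; exact: c_ge0].
  - case: nz => [t_neq0|[i iB ci]]; first by exists b => //; rewrite eqxx.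
    by move: iB => /setD1P[ib iA]; exists i => //; rewrite (negbTE ib).
  - move=> v; rewrite (big_setD1 b) //= eqxx -[RHS](sum0 v); congr (_ + _).
    by apply: eq_bigr => i /setD1P[/negbTE-> _].
(* A zero of b where the other forms are positive can be pushed slightly
   towards b > 0. *)
have push x w : (forall i, i \in B -> 0 < a i x) -> a b x = 0 -> 0 < a b w ->
    exists v, forall i, i \in A -> 0 < a i v.
  move=> ax bx bw; have [e e_gt0 xew] := @perturb_gt0 _ _ B (a^~ x) (a^~ w) ax.
  exists (e *: w + x) => i /splitA[->|iB]; rewrite a_lin.
    by rewrite bx addr0 mulr_gt0.
  by rewrite addrC xew.
have [[v av]|[c [c_ge0 c_nz c_sum]]] := IHB a a_lin; last first.
  right; apply: (extend c 0) => // [|v]; first by right.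
  by rewrite mul0r add0r.
have [bv|bv|bv] := ltgtP (a b v) 0.
(* In this case, with s as below, x + s * b x * v is the projection of x onto
   the kernel of b along v. *)
- pose s := - (a b v)^-1.
  have s_gt0 : 0 < s by rewrite oppr_gt0 invr_lt0.
  pose a' i x := a i x + s * a i v * a b x.
  have a'_lin i : scalar (a' i).
    by move=> t x y; rewrite /a' !a_lin /=; ring.
  have [[w aw]|[c [c_ge0 c_nz c_sum]]] := IHB a' a'_lin.
  + left; apply: (push ((s * a b w) *: v + w) (- v)).
    * by move=> i iB; rewrite a_lin; have := aw i iB; rewrite /a'; lra.
    * by rewrite a_lin /s; field; rewrite lt_eqF.
    * by rewrite -[- v]addr0 -scaleN1r a_lin scalar_at0 // addr0; lra.
  + right; apply: (extend c (\sum_(i in B) c i * (s * a i v))) => //.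
    * by apply: sumr_ge0 => i iB; rewrite !mulr_ge0 ?c_ge0 ?ltW ?av.
    * by right.
    * move=> x; rewrite -[RHS](c_sum x) mulr_suml -big_split /=.
      by apply: eq_bigr => i _; rewrite /a'; ring.
- by left; exists v => i /splitA[->|/av].
(* Here b v = 0: either v can be pushed, or b is the zero form, and b alone is
   a relation. *)
have [[w bw]|b0] := pselect (exists w, a b w != 0).
  left; apply: (push v (a b w *: w)) => //.
  by rewrite -[_ *: w]addr0 a_lin scalar_at0 // addr0 -expr2 exprn_even_gt0.
right; apply: (extend (fun=> 0) 1) => //; first by left; rewrite oner_neq0.
move=> x; rewrite big1 => [|i _]; last by rewrite mul0r.
by rewrite addr0 mul1r; apply/eqP/negP => /negP bx; apply: b0; exists x.
Qed.

Lemma near_line (R : realType) (n : nat) (x v : 'rV[R]_n) (P : set 'rV[R]_n) :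
  (\forall y \near x, P y) -> \forall t \near 0^'+, P (t *: v + x).
Proof.
move=> Px.
have cv : (fun t : R => t *: v + x) @ 0^'+ --> x.
  apply: cvg_at_right_filter.
  rewrite -[X in _ --> X]add0r -(scale0r v).
  by apply: cvgD; [apply: cvgZr_tmp; exact: cvg_id | exact: cvg_cst].
exact: cv.
Qed.

Lemma increase_along_direction (R : realType) (n : nat) (f : 'rV[R]_n -> R)
    (x v : 'rV[R]_n) :
  derivable f x v -> 0 < 'D_v f x -> \forall t \near 0^'+, f x < f (t *: v + x).
Proof.
move=> dfv Dgt0.
have quot : \forall t \near 0^'+, 0 < t^-1 *: (f (t *: v + x) - f x).
  exact: cvgr_gt (cvg_dnbhs_at_right dfv) _ Dgt0.
apply: filterS2 quot (nbhs_right_gt 0) => t + t_gt0.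
by rewrite pmulr_rgt0 ?invr_gt0 // subr_gt0.
Qed.

Theorem theorem3p1 (R : realType) (n m : nat) (hn : (1 <= n)%N) (hm : (1 <= m)%N)
    (Omega : set 'rV[R]_n) (Omega_neq0 : Omega !=set0) (Omega_open : open Omega)
    (f : 'I_m.+1 -> 'rV[R]_n -> R) (xhat : 'rV[R]_n)
    (hsol : is_solution Omega f xhat)
    (hdiff : forall i, gateaux_differentiable (f i) xhat)
    (hlsc : forall i, i != ord0 -> 0 < f i xhat ->
      lower_semicontinuous_at (f i) xhat) :
  (exists lambda : 'I_m.+1 -> R, fritz_john_multipliers f xhat lambda) /\
  ((exists w : 'rV[R]_n, forall i, i != ord0 -> f i xhat = 0 ->
      0 < gateaux_diff (f i) xhat w) ->
   exists lambda : 'I_m.+1 -> R,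
     fritz_john_multipliers f xhat lambda /\ lambda ord0 = 1).
Proof.
have [[xOmega x_ge0] x_max] := hsol.
have FJ : exists lambda : 'I_m.+1 -> R, fritz_john_multipliers f xhat lambda.
  pose A := [set i : 'I_m.+1 | (i == ord0) || (f i xhat == 0)]%SET.
  have lin i : scalar (gateaux_diff (f i) xhat) by case: (hdiff i).
  have [[v Dv]|[c [c_ge0 [j jA cj] c_sum]]] := gordan_alternative _ _ _ A _ lin.
    have nearO : \forall t \near 0^'+, Omega (t *: v + xhat).
      by apply: near_line; exact: open_nbhs_nbhs.
    have nearf : \forall t \near 0^'+, forall i,
        if i \in A then f i xhat < f i (t *: v + xhat)
        else 0 < f i (t *: v + xhat).
      apply: filter_forall => i /=; have [iA|iA] := boolP (i \in A).
        by apply: increase_along_direction; [case: (hdiff i) | exact: Dv].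
      apply: (near_line _ _ xhat v [set y | 0 < f i y]).
      move: iA; rewrite inE negb_or => /andP[i0 fi].
      have fi_gt0 : 0 < f i xhat by rewrite lt_neqAle eq_sym fi x_ge0.
      exact: hlsc.
    have [t [tO tf]] := filter_ex (filterI nearO nearf).
    have := x_max (t *: v + xhat); have := tf ord0; rewrite inE eqxx /=.
    move=> lt0 /(_ _); rewrite leNgt lt0 => /(_ _)/notF[]; split=> // i i0.
    have := tf i; case: ifPn => _; last exact: ltW.
    by move/ltW; apply: le_trans; exact: x_ge0.
  exists (fun i => if i \in A then c i else 0); split.
  - by move=> i; case: ifP => // /c_ge0.
  - by move=> /(congr1 (@^~ j)); rewrite jA => /eqP; apply/negP.
  - move=> i /negbTE i0; rewrite inE i0 /=.
    by case: eqP => [->|_]; rewrite ?mulr0 ?mul0r.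
  - move=> v; rewrite -[RHS](c_sum v) [RHS]big_mkcond /=.
    by apply: eq_bigr => i _; case: ifP; rewrite ?mul0r.
split=> // -[w Dw]; have [l [l_ge0 l_nz l_slack l_sum]] := FJ.
have l0_neq0 : l ord0 != 0.
  apply/eqP => l0; apply: l_nz; apply/funext => i.
  have term_ge0 j : 0 <= l j * gateaux_diff (f j) xhat w.
    have [->|j0] := eqVneq j ord0; first by rewrite l0 mul0r.
    have /eqP := l_slack j j0; rewrite mulf_eq0 => /orP[/eqP->|/eqP fj].
      by rewrite mul0r.
    by rewrite mulr_ge0 // ltW // Dw.
  have /eqP := l_sum w; rewrite psumr_eq0 // => /allP/(_ i (mem_index_enum i)).
  have [->|i0] := eqVneq i ord0; first by rewrite l0.
  have /eqP := l_slack i i0; rewrite mulf_eq0 => /orP[/eqP//|/eqP fi].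
  by rewrite mulf_eq0 (gt_eqF (Dw i i0 fi)) orbF => /eqP.
exists (fun i => (l ord0)^-1 * l i); split; last by rewrite mulVf.
split.
- by move=> i; rewrite mulr_ge0 // invr_ge0.
- by move=> /(congr1 (@^~ ord0)); rewrite mulVf //; apply/eqP/oner_neq0.
- by move=> i /l_slack; rewrite -mulrA => ->; rewrite mulr0.
- move=> v; under eq_bigr do rewrite -mulrA.
  by rewrite -mulr_sumr l_sum mulr0.
Qed.
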